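(* Given two ordered pairs of non-tangent lines $(\ell,m)$ and $(\ell', m')$ with $\ell\neq m$ and $\ell'\neq m'$, there exists an element of $G(\mathcal{O})$ mapping $(\ell,m)$ to $(\ell', m')$ if and only if (i) $\ell$ and $\ell'$ are of the same type; (ii) $m$ and $m'$ are of the same type; and (iii) $\rho(\ell,m)=\rho(\ell',m')$.
   Context: Let $q$ be a prime power and let $\mathcal{O}=\{(\xi,\xi^2,1)^\top\mid \xi\in\mathbf{F}_q\}\cup\{(0,1,0)^\top\}$ be the nonsingular conic in $\mathrm{PG}(2,q)$. For $\xi$ in an extension field $\mathbf{F}_{q^m}$ write $P_\xi=(\xi,\xi^2,1)^\top$ and $P_\infty=(0,1,0)^\top$, and let $\mathcal{O}_{q^2}=\{P_\xi\mid \xi\in\mathbf{F}_{q^2}\cup\{\infty\}\}$. The group $\mathrm{PGL}(2,q)$ acts on $\mathbf{F}_q\cup\{\infty\}$ (and on $\mathbf{F}_{q^2}\cup\{\infty\}$) by $x\mapsto (ax+b)/(cx+d)$, and is embedded in $\mathrm{PGL}(3,q)$ via $\begin{pmatrix}a&b\\c&d\end{pmatrix}\mapsto\begin{pmatrix}ad+bc&ac&bd\\2ab&a^2&b^2\\2cd&c^2&d^2\end{pmatrix}$; the image $G(\mathcal{O})$ is the subgroup of $\mathrm{PGL}(3,q)$ fixing $\mathcal{O}$, and it maps $P_\xi$ to $P_{A(\xi)}$. A non-tangent line $\ell$ of $\mathcal{O}$ in $\mathrm{PG}(2,q)$ (viewed as a line of $\mathrm{PG}(2,q^2)$) meets $\mathcal{O}_{q^2}$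 in two points $P_\alpha,P_\beta$; $\ell$ is hyperbolic (secant) if $\alpha,\beta\in\mathbf{F}_q\cup\{\infty\}$ and elliptic (exterior) if $\beta=\alpha^q$ with $\alpha\in\mathbf{F}_{q^2}\setminus\mathbf{F}_q$; these are the two ''types''. The cross-ratio of four elements (no three equal) is $\rho(\alpha,\beta,\gamma,\delta)=\frac{(\alpha-\gamma)(\beta-\delta)}{(\alpha-\delta)(\beta-\gamma)}$ (with the usual interpretation when some entries are $\infty$). For non-tangent lines $\ell,m$ with $\ell\cap\mathcal{O}_{q^2}=\{P_\alpha,P_\beta\}$ and $m\cap\mathcal{O}_{q^2}=\{P_\gamma,P_\delta\}$, the cross-ratio of the lines is defined as $\rho(\ell,m)=\{r,r^{-1}\}$ where $r=\rho(\alpha,\beta,\gamma,\delta)$. *)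

(* Defs.v *)
From HB Require Import structures.
From mathcomp Require Import all_boot all_order all_fingroup all_algebra.

Set Implicit Arguments.
Unset Strict Implicit.
Unset Printing Implicit Defensive.

Import GRing.Theory.
Local Open Scope ring_scope.

(* The projective line K u {infinity} is [option K], with infinity = [None].
   The projective plane PG(2, K) is the lattice of subspaces of 'cV[K]_3:
   points are the 1-dimensional subspaces (given here by a spanning vector)
   and lines are the 2-dimensional ones. *)

Definition conic_pt (K : fieldType) (x : option K) : 'cV[K]_3 :=
  if x is Some t then \col_(i < 3) [:: t; t ^+ 2; 1]`_i
  else \col_(i < 3) [:: 0; 1; 0]`_i.

Definition is_line (K : fieldType) (l : {vspace 'cV[K]_3}) : bool :=
  \dim l == 2%N.

(* [conic_pt] is injective up to scalars, so counting parameters is the same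
   as counting points of the conic. *)
Definition tangent (F : finFieldType) (l : {vspace 'cV[F]_3}) : bool :=
  is_line l && (#|[set x : option F | conic_pt x \in l]| == 1%N).

Definition nontangent_line (F : finFieldType) (l : {vspace 'cV[F]_3}) : bool :=
  is_line l && ~~ tangent l.

(* The embedding of PGL(2, K) in PGL(3, K), on representatives
   A = (a, b; c, d); it satisfies
   conic_mx A *m (t, t^2, 1)
     = ((at + b)(ct + d), (at + b)^2, (ct + d)^2). *)
Definition conic_mx (K : fieldType) (A : 'M[K]_2) : 'M[K]_3 :=
  let a := A 0 0 in let b := A 0 1 in let c := A 1 0 in let d := A 1 1 in
  \matrix_(i < 3, j < 3)
    (nth [::] [:: [:: a * d + b * c; a * c; b * d];
                  [:: (a * b) *+ 2; a ^+ 2; b ^+ 2];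
                  [:: (c * d) *+ 2; c ^+ 2; d ^+ 2]] i)`_j.

(* G(O) is represented by its full preimage in GL(3, q): the scalar multiples
   of the matrices of the embedding. Scalars act trivially on subspaces, so
   this group and its quotient in PGL(3, q) induce the same maps on lines. *)
Definition conic_group (F : finFieldType) : {set {'GL_3[F]}} :=
  [set g : {'GL_3[F]} | [exists A : {'GL_2[F]}, exists c : F,
     (c != 0) && (GLval g == c *: conic_mx (GLval A))]].

Definition line_image (F : finFieldType) (g : {'GL_3[F]})
    (l : {vspace 'cV[F]_3}) : {vspace 'cV[F]_3} :=
  (linfun (mulmx (GLval g) : 'cV[F]_3 -> 'cV[F]_3) @: l)%VS.

(* Brackets [x, y] = x1 y2 - x2 y1 in homogeneous coordinates (t, 1) for t in K
   and (1, 0) for infinity; for finite x, y this is x - y. *)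
Definition bracket (K : fieldType) (x y : option K) : K :=
  match x, y with
  | Some s, Some t => s - t
  | Some _, None => -1
  | None, Some _ => 1
  | None, None => 0
  end.

(* Numerator and denominator both vanish only if three of the four arguments
   are equal; otherwise a zero denominator means that the value is infinity. *)
Definition cross_ratio (K : fieldType) (a b c d : option K) : option K :=
  let num := bracket a c * bracket b d in
  let den := bracket a d * bracket b c in
  if den == 0 then None else Some (num / den).

Definition proj_inv (K : fieldType) (x : option K) : option K :=
  if x is Some t then (if t == 0 then None else Some t^-1) else Some 0.

Section QuadraticExtension.

Variables (F L : finFieldType) (iota : {rmorphism F -> L}).

(* A line of PG(2, q) viewed as a line of PG(2, q^2). *)
Definition ext_line (l : {vspace 'cV[F]_3}) : {vspace 'cV[L]_3} :=
  <<[seq map_mx iota v | v <- vbasis l]>>%VS.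

Definition conic_params (l : {vspace 'cV[F]_3}) : {set option L} :=
  [set x : option L | conic_pt x \in ext_line l].

Definition hyperbolic (l : {vspace 'cV[F]_3}) : Prop :=
  exists a b : option F,
    a != b /\ conic_params l = [set omap iota a; omap iota b].

Definition elliptic (l : {vspace 'cV[F]_3}) : Prop :=
  exists a : L,
    a \notin codom iota /\ conic_params l = [set Some a; Some (a ^+ #|F|)].

Definition same_type (l l' : {vspace 'cV[F]_3}) : Prop :=
  (hyperbolic l /\ hyperbolic l') \/ (elliptic l /\ elliptic l').

(* The union of {r, r^-1} over all labellings {a, b}, {c, d} of the two pairs
   of conic points; exchanging a and b, or c and d, replaces r by r^-1, so all
   the sets in this union coincide. *)
Definition line_cross_ratio (l m : {vspace 'cV[F]_3}) : {set option L} :=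
  [set x : option L |
    [exists a : option L, exists b : option L,
     exists c : option L, exists d : option L,
      [&& a != b, conic_params l == [set a; b],
          c != d, conic_params m == [set c; d]
        & x \in [set cross_ratio a b c d; proj_inv (cross_ratio a b c d)]]]].

End QuadraticExtension.

(* Main.v *)
Require Import Defs.
From HB Require Import structures.
From mathcomp Require Import all_boot all_order all_fingroup all_algebra all_field.
From mathcomp Require Import ring.

Set Implicit Arguments.
Unset Strict Implicit.
Unset Printing Implicit Defensive.

Import GRing.Theory.
Local Open Scope ring_scope.

(** A Moebius map A of the parameter line carries the conic points of a line l to
    those of its image, so it preserves cross-ratios, and it commutes with the
    Frobenius x |-> x^q, which fixes the two conic points of a hyperbolic line and
    swaps those of an elliptic one.
    Conversely, given lines with parameters {a, b}, {c, d} and {a', b'}, {c', d'},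
    label them so that a, b, c are distinct, a', b', c' are distinct and the
    cross-ratios agree. The map M over F_{q^2} taking a, b, c to a', b', c' then takes
    d to d'. As the types agree, the Frobenius conjugate of M does the same, so by
    uniqueness it is proportional to M; hence M is a multiple of a matrix over F_q.
    A line is determined by its two conic points, so M induces the required element
    of G(O). *)

(** * Moebius maps and cross-ratios on the projective line over a field *)

Section ProjectiveLine.

Variable K : fieldType.
Implicit Types (x y z a b c d : option K) (u v : 'cV[K]_2) (A B : 'M[K]_2).

Definition hom_coord x : 'cV[K]_2 :=
  if x is Some t then \col_i [:: t; 1]`_i else \col_i [:: 1; 0]`_i.

(** The zero vector is sent to infinity as well, which is why [dehomK] excludes it. *)
Definition dehom u : option K :=
  if u 1 0 == 0 then None else Some (u 0 0 / u 1 0).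

Definition brk u v : K := u 0 0 * v 1 0 - u 1 0 * v 0 0.

Definition mob A x : option K := dehom (A *m hom_coord x).

Lemma ord2_eq (i : 'I_2) : (i = 0) \/ (i = 1).
Proof. by case: i => [[|[|i]] Hi] //; [left|right]; apply: val_inj. Qed.

Lemma col2P u v : u 0 0 = v 0 0 -> u 1 0 = v 1 0 -> u = v.
Proof. by move=> e0 e1; apply/colP=> i; case: (ord2_eq i) => ->. Qed.

Lemma mulmx_col2 A u i : (A *m u) i 0 = A i 0 * u 0 0 + A i 1 * u 1 0.
Proof.
rewrite mxE !big_ord_recl big_ord0 addr0.
by congr (_ + A i _ * u _ _); apply: val_inj.
Qed.

Lemma det_mx2 A : \det A = A 0 0 * A 1 1 - A 0 1 * A 1 0.
Proof.
rewrite (expand_det_row _ 0) !big_ord_recl big_ord0 addr0 /cofactor !det_mx11.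
rewrite !mxE /= mul1r expr1 mulN1r mulrN.
by congr (_ * A _ _ - A _ _ * A _ _); apply: val_inj.
Qed.

Lemma bracketE x y : bracket x y = brk (hom_coord x) (hom_coord y).
Proof. by case: x y => [s|] [t|]; rewrite /brk !mxE /=; ring. Qed.

Lemma brk_mulmx A u v : brk (A *m u) (A *m v) = \det A * brk u v.
Proof. by rewrite /brk !mulmx_col2 det_mx2; ring. Qed.

Lemma brkZ k1 k2 u v : brk (k1 *: u) (k2 *: v) = k1 * k2 * brk u v.
Proof. by rewrite /brk !mxE; ring. Qed.

Lemma bracket_eq0 x y : (bracket x y == 0) = (x == y).
Proof.
case: x y => [s|] [t|] /=; last by rewrite !eqxx.
- by rewrite subr_eq0.
- by rewrite oppr_eq0 oner_eq0.
- by rewrite oner_eq0.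
Qed.

Lemma bracketC x y : bracket x y = - bracket y x.
Proof. by rewrite !bracketE /brk; ring. Qed.

Lemma hom_coord_neq0 x : hom_coord x != 0.
Proof.
apply/eqP=> /colP h; case: x h => [t|] h.
  by move: (h 1); rewrite !mxE /= => /eqP; rewrite oner_eq0.
by move: (h 0); rewrite !mxE /= => /eqP; rewrite oner_eq0.
Qed.

Lemma dehomK u : u != 0 -> exists2 k : K, k != 0 & u = k *: hom_coord (dehom u).
Proof.
rewrite /dehom => u0; case: eqVneq => [u1|u1].
  exists (u 0 0).
    by apply: contraNneq u0 => u00; apply/eqP/col2P; rewrite !mxE.
  by apply: col2P; rewrite !mxE /= ?mulr1 ?mulr0.
by exists (u 1 0) => //; apply: col2P; rewrite !mxE /= ?mulr1 // mulrC divfK.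
Qed.

Lemma mulmx_hom_coord A x : A \in unitmx ->
  exists2 k : K, k != 0 & A *m hom_coord x = k *: hom_coord (mob A x).
Proof.
move=> uA; apply: dehomK; apply: contraNneq (hom_coord_neq0 x) => A0.
by rewrite -(mulKmx uA (hom_coord x)) A0 mulmx0.
Qed.

(** Turns an equation between points into a polynomial identity within reach of [ring], with
    infinity treated like any other point. *)
Lemma mob_eqE A x y : A \in unitmx ->
  (mob A x == y) = (brk (A *m hom_coord x) (hom_coord y) == 0).
Proof.
move=> uA; have [k k0 ->] := mulmx_hom_coord x uA.
rewrite -[hom_coord y]scale1r brkZ -bracketE mulr1 mulf_eq0 (negPf k0) /=.
by rewrite bracket_eq0.
Qed.

Lemma mob_unique A x y k : A \in unitmx ->
  A *m hom_coord x = k *: hom_coord y -> mob A x = y.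
Proof.
move=> uA e; apply/eqP; rewrite mob_eqE // e -[X in brk _ X]scale1r brkZ.
by rewrite -bracketE (eqP (_ : bracket y y == 0)) ?mulr0 // bracket_eq0.
Qed.

Lemma mob_mulmx A B x : A \in unitmx -> B \in unitmx ->
  mob (A *m B) x = mob A (mob B x).
Proof.
move=> uA uB; have [k _ ek] := mulmx_hom_coord x uB.
have [h _ eh] := mulmx_hom_coord (mob B x) uA.
apply: (@mob_unique _ _ _ (k * h)); first by rewrite unitmx_mul uA.
by rewrite -mulmxA ek -scalemxAr eh scalerA.
Qed.

Lemma mob1 x : mob 1%:M x = x.
Proof. by apply: (@mob_unique _ _ _ 1); rewrite ?unitmx1 // mul1mx scale1r. Qed.

Lemma mobK A : A \in unitmx -> cancel (mob A) (mob (invmx A)).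
Proof. by move=> uA x; rewrite -mob_mulmx ?unitmx_inv // mulVmx // mob1. Qed.

Lemma mobKV A : A \in unitmx -> cancel (mob (invmx A)) (mob A).
Proof. by move=> uA x; rewrite -mob_mulmx ?unitmx_inv // mulmxV // mob1. Qed.

Lemma mobZ k A x : k != 0 -> A \in unitmx -> mob (k *: A) x = mob A x.
Proof.
move=> k0 uA; have [h _ eh] := mulmx_hom_coord x uA.
apply: (@mob_unique _ _ _ (k * h)); last by rewrite -scalemxAl eh scalerA.
by rewrite unitmxE detZ unitfE mulf_neq0 ?expf_neq0 // -unitfE -unitmxE.
Qed.

(** Under [A] a bracket [x, y] is multiplied by det A / (kx ky). Numerator and denominator each
    contain every one of the four points once, so both acquire the same factor [h]. *)
Lemma cross_ratio_mob A a b c d : A \in unitmx ->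
  cross_ratio (mob A a) (mob A b) (mob A c) (mob A d) = cross_ratio a b c d.
Proof.
move=> uA; have dA : \det A != 0 by rewrite -unitfE -unitmxE.
have [ka ka0 ea] := mulmx_hom_coord a uA.
have [kb kb0 eb] := mulmx_hom_coord b uA.
have [kc kc0 ec] := mulmx_hom_coord c uA.
have [kd kd0 ed] := mulmx_hom_coord d uA.
have brkM x y kx ky : kx != 0 -> ky != 0 ->
    A *m hom_coord x = kx *: hom_coord (mob A x) ->
    A *m hom_coord y = ky *: hom_coord (mob A y) ->
  bracket (mob A x) (mob A y) = \det A / (kx * ky) * bracket x y.
  move=> kx0 ky0 ex ey; rewrite !bracketE.
  apply: (mulfI (mulf_neq0 kx0 ky0)); rewrite -brkZ -ex -ey brk_mulmx.
  by field; rewrite ?kx0 ?ky0.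
pose h := \det A ^+ 2 / (ka * kb * kc * kd).
have h0 : h != 0 by rewrite /h mulf_neq0 ?invr_eq0 ?expf_neq0 ?mulf_neq0.
rewrite /cross_ratio (brkM a c ka kc) // (brkM b d kb kd) //.
rewrite (brkM a d ka kd) // (brkM b c kb kc) //.
rewrite (_ : _ * (_ * bracket b c) = h * (bracket a d * bracket b c)); last first.
  by rewrite /h; field; rewrite ka0 kb0 kc0 kd0.
rewrite (_ : _ * (_ * bracket b d) = h * (bracket a c * bracket b d)); last first.
  by rewrite /h; field; rewrite ka0 kb0 kc0 kd0.
rewrite mulf_eq0 (negPf h0) /=; case: eqVneq => // den0.
by rewrite -(mulf_div h) divff // mul1r.
Qed.

(** The exchange swaps numerator and denominator. They cannot both vanish, as that would force a = b
    or c = d, so the values zero and infinity are exchanged correctly. *)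
Lemma cross_ratio_swap12 a b c d : a != b -> c != d ->
  cross_ratio b a c d = proj_inv (cross_ratio a b c d).
Proof.
move=> ab cd; rewrite /cross_ratio /proj_inv.
rewrite ![bracket b _ * _]mulrC; set n := bracket a c * _; set m := bracket a d * _.
have nm : (n != 0) || (m != 0).
  apply: contraTT cd => /norP[]; rewrite !negbK !mulf_eq0 !bracket_eq0.
  by case/orP=> /eqP e1 /orP[] /eqP e2; move: ab; rewrite -?e1 -?e2 ?e1 ?e2 eqxx.
case: (eqVneq n 0) nm => [->|n0 _]; first by move=> /= /negPf ->; rewrite mul0r eqxx.
case: eqVneq => [->|m0]; first by rewrite mul0r.
by rewrite mulf_eq0 invr_eq0 (negPf n0) (negPf m0) /= invf_div.
Qed.

Lemma cross_ratio_swap34 a b c d :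
  cross_ratio a b d c = cross_ratio b a c d.
Proof. by rewrite /cross_ratio ![bracket a _ * _]mulrC. Qed.

Lemma proj_invK : involutive (@proj_inv K).
Proof.
case=> [t|] /=; last by rewrite eqxx.
by case: eqVneq => [->|t0] //=; rewrite invr_eq0 (negPf t0) invrK.
Qed.

Lemma cross_ratio_inj a b c d d' :
    a != b -> a != c -> b != c ->
  cross_ratio a b c d = cross_ratio a b c d' -> d = d'.
Proof.
rewrite -!bracket_eq0 => ab ac bc; rewrite /cross_ratio !mulf_eq0 (negPf bc) !orbF.
case: eqVneq => [ad|ad]; case: eqVneq => [ad'|ad'] //.
  by move/eqP: ad; move/eqP: ad'; rewrite !bracket_eq0 => /eqP<- /eqP<-.
move=> [] /eqP; rewrite eqr_div ?mulf_neq0 // => /eqP e.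
apply/eqP; rewrite -bracket_eq0; move: e => /eqP; rewrite -subr_eq0.
(* The Plücker relation for a, b, d, d', multiplied by [a, c] [b, c]. *)
have -> : bracket a c * bracket b d * (bracket a d' * bracket b c) -
    bracket a c * bracket b d' * (bracket a d * bracket b c) =
    bracket a c * bracket b c * (bracket a b * bracket d' d).
  by rewrite !bracketE /brk; ring.
by rewrite !mulf_eq0 (negPf ac) (negPf bc) (negPf ab) /= bracketC oppr_eq0.
Qed.

Lemma mob_transitive3 a b c a' b' c' :
    a != b -> a != c -> b != c -> a' != b' -> a' != c' -> b' != c' ->
  exists2 A, A \in unitmx & [/\ mob A a = a', mob A b = b' & mob A c = c'].
Proof.
rewrite -!bracket_eq0 => ab ac bc ab' ac' bc'.
(* [A *m u = k1 [u, b] a' + k2 [a, u] b'], with [k1] and [k2] chosen so that [c] goes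
   to a multiple of [c']. *)
pose k1 := bracket b' c' * bracket a c; pose k2 := bracket a' c' * bracket b c.
pose coef (x : option K) i := hom_coord x i 0.
pose A : 'M[K]_2 := \matrix_(i, j)
  if j == 0 then k1 * coef b 1 * coef a' i - k2 * coef a 1 * coef b' i
  else - k1 * coef b 0 * coef a' i + k2 * coef a 0 * coef b' i.
have dA : \det A = k1 * k2 * bracket a b * bracket a' b'.
  by rewrite det_mx2 !mxE /= !bracketE /brk /coef; ring.
have uA : A \in unitmx by rewrite unitmxE unitfE dA !mulf_neq0.
exists A => //; split; apply/eqP; rewrite mob_eqE // /brk !mulmx_col2 !mxE /=;
  rewrite /k1 /k2 !bracketE /brk /coef; apply/eqP; ring.
Qed.

(** Expanding z in the basis x, y shows that the polar value [B] is zero too. Up to the factor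
    [x, y]^2, each coefficient is a combination of [Q x], [Q y] and [B]. Nothing is divided by 2, so
    characteristic 2 is covered. *)
Lemma binary_quadratic_form_eq0 x y z (w0 w1 w2 : K) :
    x != y -> x != z -> y != z ->
    let Q (t : option K) := let u := hom_coord t in
      w0 * (u 0 0 * u 1 0) + w1 * u 0 0 ^+ 2 + w2 * u 1 0 ^+ 2 in
    Q x = 0 -> Q y = 0 -> Q z = 0 ->
  [/\ w0 = 0, w1 = 0 & w2 = 0].
Proof.
rewrite -!bracket_eq0 => xy xz yz Q Qx Qy Qz.
set u := hom_coord x in Qx; set v := hom_coord y in Qy.
(* polar form of [Q] at [x], [y] *)
pose B := w0 * (u 0 0 * v 1 0 + u 1 0 * v 0 0)
  + (w1 * (u 0 0 * v 0 0)) *+ 2 + (w2 * (u 1 0 * v 1 0)) *+ 2.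
have BE : bracket x y ^+ 2 * Q z = bracket y z ^+ 2 * Q x + bracket x z ^+ 2 * Q y
    - bracket y z * bracket x z * B.
  by rewrite /B /Q /u /v !bracketE /brk /=; ring.
have B0 : B = 0.
  move: BE; rewrite Qx Qy Qz !mulr0 !add0r => /eqP; rewrite eq_sym oppr_eq0.
  by rewrite !mulf_eq0 (negPf yz) (negPf xz) => /eqP.
have xy2 : bracket x y ^+ 2 != 0 by rewrite expf_neq0.
have w0E : bracket x y ^+ 2 * w0 =
  - (v 0 0 * v 1 0) *+ 2 * Q x - (u 0 0 * u 1 0) *+ 2 * Q y
  + (v 1 0 * u 0 0 + u 1 0 * v 0 0) * B.
  by rewrite /B /Q /u /v !bracketE /brk /=; ring.
have w1E : bracket x y ^+ 2 * w1 =
  v 1 0 ^+ 2 * Q x + u 1 0 ^+ 2 * Q y - u 1 0 * v 1 0 * B.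
  by rewrite /B /Q /u /v !bracketE /brk /=; ring.
have w2E : bracket x y ^+ 2 * w2 =
  v 0 0 ^+ 2 * Q x + u 0 0 ^+ 2 * Q y - u 0 0 * v 0 0 * B.
  by rewrite /B /Q /u /v !bracketE /brk /=; ring.
by split; apply: (mulfI xy2); rewrite ?w0E ?w1E ?w2E Qx Qy B0; ring.
Qed.

(** The fixed points of [A] are the zeros of the quadratic form [A u, u], whose coefficients are A00
    - A11, - A10 and A01; three zeros make them all vanish. *)
Lemma scalar_mx_of_fixpoints A x y z : A \in unitmx ->
    x != y -> x != z -> y != z ->
    mob A x = x -> mob A y = y -> mob A z = z ->
  exists2 k : K, k != 0 & A = k%:M.
Proof.
move=> uA xy xz yz /eqP + /eqP + /eqP.
rewrite !mob_eqE // /brk !mulmx_col2 => /eqP fx /eqP fy /eqP fz.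
have [|||/eqP + /eqP + A01] :=
    @binary_quadratic_form_eq0 x y z (A 0 0 - A 1 1) (- A 1 0) (A 0 1) xy xz yz.
- by rewrite -[RHS]fx /=; ring.
- by rewrite -[RHS]fy /=; ring.
- by rewrite -[RHS]fz /=; ring.
rewrite subr_eq0 oppr_eq0 => /eqP A00 /eqP A10.
exists (A 1 1).
  by move: uA; rewrite unitmxE unitfE det_mx2 A01 mul0r subr0 mulf_eq0 => /norP[].
apply/matrixP=> i j; rewrite !mxE.
by case: (ord2_eq i) => ->; case: (ord2_eq j) => ->; rewrite /= ?mulr1n ?mulr0n.
Qed.

Lemma mob_proportional A B x y z : A \in unitmx -> B \in unitmx ->
    x != y -> x != z -> y != z ->
    mob A x = mob B x -> mob A y = mob B y -> mob A z = mob B z ->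
  exists2 k : K, k != 0 & A = k *: B.
Proof.
move=> uA uB xy xz yz ex ey ez.
have uB' : invmx B \in unitmx by rewrite unitmx_inv.
have [||||k k0 e] := @scalar_mx_of_fixpoints (invmx B *m A) x y z _ xy xz yz.
- by rewrite unitmx_mul uB'.
- by rewrite mob_mulmx // ex mobK.
- by rewrite mob_mulmx // ey mobK.
- by rewrite mob_mulmx // ez mobK.
by exists k; rewrite // -(mulKVmx uB A) e mul_mx_scalar.
Qed.

(** * The conic as a Veronese curve *)

Definition veronese u : 'cV[K]_3 :=
  \col_(i < 3) [:: u 0 0 * u 1 0; u 0 0 ^+ 2; u 1 0 ^+ 2]`_i.

Lemma conic_pt_veronese x : conic_pt x = veronese (hom_coord x).
Proof.
apply/colP=> i; case: x => [t|]; rewrite !mxE /=.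
  by rewrite mulr1 expr1n.
by rewrite mulr0 expr1n expr0n.
Qed.

Lemma veroneseZ k u : veronese (k *: u) = k ^+ 2 *: veronese u.
Proof.
apply/colP=> i; rewrite !mxE.
by case: i => [[|[|[|i]]] Hi] //=; ring.
Qed.

(** [conic_mx A] is the action of [A] on the quadratic monomials u0 u1, u0^2, u1^2. *)
Lemma conic_mx_veronese A u : conic_mx A *m veronese u = veronese (A *m u).
Proof.
apply/colP=> i; rewrite [RHS]mxE !mulmx_col2 mxE !big_ord_recl big_ord0 !mxE.
by case: i => [[|[|[|i]]] Hi] //=; ring.
Qed.

(** Multiplicativity yields the inverse of [conic_mx A], so that no determinant of size 3 has to be
    computed. *)
Lemma conic_mxM A B : conic_mx (A *m B) = conic_mx A *m conic_mx B.
Proof.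
have ABE i j : (A *m B) i j = A i 0 * B 0 j + A i 1 * B 1 j.
  rewrite mxE !big_ord_recl big_ord0 addr0.
  by congr (_ + A i _ * B _ j); apply: val_inj.
apply/matrixP=> i j; rewrite [RHS]mxE !big_ord_recl big_ord0 /conic_mx !ABE !mxE.
by case: i => [[|[|[|i]]] Hi] //; case: j => [[|[|[|j]]] Hj] //=; ring.
Qed.

Lemma conic_mx1 : conic_mx 1%:M = 1%:M :> 'M[K]_3.
Proof.
apply/matrixP=> i j; rewrite /conic_mx !mxE /=.
by case: i => [[|[|[|i]]] Hi] //; case: j => [[|[|[|j]]] Hj] //=;
  rewrite ?mulr1n ?mulr0n; ring.
Qed.

Lemma conic_mx_unit A : A \in unitmx -> conic_mx A \in unitmx.
Proof.
by move=> uA; case: (@mulmx1_unit _ _ (conic_mx A) (conic_mx (invmx A)));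
  rewrite // -conic_mxM mulmxV // conic_mx1.
Qed.

Lemma conic_mx_conic_pt A x : A \in unitmx ->
  exists2 k : K, k != 0 & conic_mx A *m conic_pt x = k *: conic_pt (mob A x).
Proof.
move=> uA; have [k k0 e] := mulmx_hom_coord x uA.
exists (k ^+ 2); first by rewrite expf_neq0.
by rewrite !conic_pt_veronese conic_mx_veronese e veroneseZ.
Qed.

Lemma conic_pt_free x y : x != y -> free [:: conic_pt x; conic_pt y].
Proof.
rewrite -bracket_eq0 => xy; rewrite free_cons span_seq1 seq1_free.
apply/andP; split; last first.
  apply: contraNneq xy => y0; rewrite bracketE /brk.
  move/colP: y0; rewrite conic_pt_veronese => y0.
  have := y0 1; have := y0 2%:R; rewrite !mxE /= => /eqP + /eqP.
  by rewrite !expf_eq0 /= => /eqP -> /eqP ->; rewrite !mulr0 subrr.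
apply: contraNN xy => /vlineP[k]; rewrite !conic_pt_veronese => /colP e.
have := e 0; have := e 1; have := e 2%:R; rewrite !mxE /= => e2 e1 e0.
rewrite -sqrf_eq0 bracketE /brk; apply/eqP.
set u := hom_coord x in e0 e1 e2 *; set v := hom_coord y in e0 e1 e2 *.
(* [u, v]^2 is bilinear in the two Veronese vectors; replacing that of u by k times that of v gives
   k [v, v]^2 = 0. *)
transitivity (u 0 0 ^+ 2 * v 1 0 ^+ 2 - (u 0 0 * u 1 0 * (v 0 0 * v 1 0)) *+ 2
              + u 1 0 ^+ 2 * v 0 0 ^+ 2); first by ring.
by rewrite e0 e1 e2; ring.
Qed.

End ProjectiveLine.

(** * Compatibility with field morphisms *)

Section ChangeOfField.

Variables (K K' : fieldType) (f : {rmorphism K -> K'}).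

Lemma map_hom_coord x : map_mx f (hom_coord x) = hom_coord (omap f x).
Proof.
by apply/colP=> i; case: (ord2_eq i) => ->; case: x => [t|]; rewrite !mxE /= ?rmorph1 ?rmorph0.
Qed.

Lemma map_conic_mx A : map_mx f (conic_mx A) = conic_mx (map_mx f A).
Proof.
apply/matrixP=> i j; rewrite !mxE.
by case: i => [[|[|[|i]]] Hi] //; case: j => [[|[|[|j]]] Hj] //=;
   rewrite ?rmorphMn ?rmorphD ?rmorphM ?rmorphXn.
Qed.

Lemma mob_map A x : A \in unitmx ->
  mob (map_mx f A) (omap f x) = omap f (mob A x).
Proof.
move=> uA; have [k _ e] := mulmx_hom_coord x uA.
apply: (@mob_unique _ _ _ _ (f k)); first by rewrite map_unitmx.
by rewrite -!map_hom_coord -map_mxM e map_mxZ.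
Qed.

End ChangeOfField.

(** * Spans under extension of scalars and linear images *)

Lemma mem_span_submx (K : fieldType) m n (X : n.-tuple 'cV[K]_m) v :
  (v \in <<X>>%VS) = (v^T <= \matrix_(i < n) (tnth X i)^T)%MS.
Proof.
apply/idP/submxP=> [/coord_span vE|[D vE]].
  exists (\row_i coord X i v); rewrite mulmx_sum_row {1}vE raddf_sum /=.
  by apply: eq_bigr => i _; rewrite linearZ /= mxE rowK (tnth_nth 0).
rewrite -(trmxK v) vE mulmx_sum_row raddf_sum /=; apply: memv_suml => i _.
by rewrite linearZ /= rowK trmxK memvZ // memv_span // mem_tnth.
Qed.

Lemma mem_span_map_submx (K K' : fieldType) (f : {rmorphism K -> K'}) m n
    (X : n.-tuple 'cV[K]_m) v :
  (v \in <<[seq map_mx f x | x <- X]>>%VS) =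
  (v^T <= map_mx f (\matrix_(i < n) (tnth X i)^T))%MS.
Proof.
rewrite -[X in <<X>>%VS]/(tval (map_tuple (map_mx f) X)) mem_span_submx.
congr (_ <= _)%MS.
by apply/row_matrixP=> i; rewrite -map_row !rowK tnth_map map_trmx.
Qed.

(** Solvability of a linear system does not depend on the field; in terms of row spaces this is
    [map_submx]. *)
Lemma mem_span_map_mx (K K' : fieldType) (f : {rmorphism K -> K'}) m n
    (X : n.-tuple 'cV[K]_m) v :
  (map_mx f v \in <<[seq map_mx f x | x <- X]>>%VS) = (v \in <<X>>%VS).
Proof.
by rewrite mem_span_map_submx mem_span_submx map_trmx map_submx.
Qed.

Lemma mem_limg_mulmx (K : fieldType) m (M : 'M[K]_m.+1) (U : {vspace 'cV[K]_m.+1}) v :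
  M \in unitmx ->
  (M *m v \in (linfun (mulmx M : 'cV[K]_m.+1 -> 'cV[K]_m.+1) @: U)%VS) = (v \in U).
Proof.
move=> uM; apply/memv_imgP/idP=> [[u Uu]|Uv]; last by exists v; rewrite ?lfunE.
by rewrite lfunE /= => /(congr1 (mulmx (invmx M))); rewrite !mulKmx // => ->.
Qed.

(** * Lines and their conic points over the larger field *)

Section QuadraticExtension.

Variables (F L : finFieldType) (iota : {rmorphism F -> L}).

Implicit Types (l : {vspace 'cV[F]_3}) (A : 'M[F]_2).

Lemma mem_ext_line l v : (map_mx iota v \in ext_line iota l) = (v \in l).
Proof. by rewrite mem_span_map_mx (span_basis (vbasisP l)). Qed.

(** Frees [ext_line] from the basis [vbasis] in its definition, so that linear maps can be pushed
    through it. *)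
Lemma ext_line_span (X : seq 'cV[F]_3) :
  ext_line iota <<X>>%VS = <<[seq map_mx iota x | x <- X]>>%VS.
Proof.
apply/eqP; rewrite eqEsubv; apply/andP; split; apply/span_subvP=> _ /mapP[v Xv ->].
  by rewrite (mem_span_map_mx iota (in_tuple X)) vbasis_mem.
by rewrite mem_ext_line memv_span.
Qed.

Lemma ext_line_image (g : {'GL_3[F]}) l :
  ext_line iota (line_image g l) =
  (linfun (mulmx (map_mx iota (GLval g)) : 'cV[L]_3 -> 'cV[L]_3) @: ext_line iota l)%VS.
Proof.
rewrite /line_image -{1}(span_basis (vbasisP l)) limg_span ext_line_span limg_span.
by rewrite -!map_comp; congr <<_>>%VS; apply: eq_map => v /=; rewrite !lfunE /= map_mxM.
Qed.

Lemma conic_params_image (g : {'GL_3[F]}) A c l :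
    A \in unitmx -> c != 0 -> GLval g = c *: conic_mx A ->
  conic_params iota (line_image g l) = mob (map_mx iota A) @: conic_params iota l.
Proof.
move=> uA c0 gE; set B := map_mx iota A.
have uB : B \in unitmx by rewrite map_unitmx.
(* [g] sends each conic point to a nonzero multiple of the one with parameter [mob B x]; bijectivity
   of [mob B] then gives the equality of sets. *)
have memE x : (mob B x \in conic_params iota (line_image g l)) = (x \in conic_params iota l).
  rewrite !inE ext_line_image gE map_mxZ map_conic_mx.
  have uM : iota c *: conic_mx B \in unitmx.
    rewrite unitmxE detZ unitfE mulf_neq0 ?expf_neq0 ?fmorph_eq0 //.
    by rewrite -unitfE -unitmxE conic_mx_unit.
  have [k k0 e] := conic_mx_conic_pt x uB.
  rewrite -[RHS](mem_limg_mulmx _ _ uM) -[X in _ = (X \in _)]scalemxAl e scalerA.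
  by rewrite rpredZeq mulf_eq0 fmorph_eq0 (negPf c0) (negPf k0).
apply/setP=> y; apply/idP/imsetP=> [|[x lx ->]]; last by rewrite memE.
by rewrite -(mobKV uB y) memE => lx; exists (mob (invmx B) y).
Qed.

(** Two independent vectors span a space that has dimension at most 2. *)
Lemma ext_line_conic_pts l x y : is_line l -> x != y ->
    x \in conic_params iota l -> y \in conic_params iota l ->
  ext_line iota l = <<[:: conic_pt x; conic_pt y]>>%VS.
Proof.
move=> /eqP dl xy; rewrite !inE => lx ly.
apply/esym/eqP; rewrite eqEdim; apply/andP; split.
  by apply/span_subvP=> v; rewrite !inE => /orP[]/eqP->.
rewrite (eqP (conic_pt_free xy)) /= (leq_trans (dim_span _)) //.
by rewrite size_map size_tuple dl.
Qed.

Lemma conic_params_inj l l' a b : is_line l -> is_line l' -> a != b ->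
    conic_params iota l = [set a; b] -> conic_params iota l' = [set a; b] ->
  l = l'.
Proof.
move=> dl dl' ab pl pl'; apply/vspaceP=> v; rewrite -!(mem_ext_line _ v).
by rewrite !(@ext_line_conic_pts _ a b) // ?pl ?pl' !inE eqxx ?orbT.
Qed.

(** * The Frobenius of L relative to F *)

Lemma pchar_nat_card : [pchar L].-nat #|F|.
Proof.
have [p p_pr pF] := finPcharP F.
have cF : #|F| = (p ^ logn p #|F|)%N := card_pprimeChar pF.
rewrite cF pnatX; apply/orP; left.
by rewrite pnatE // (rmorph_pchar iota pF).
Qed.

Definition frob (x : L) : L := x ^+ #|F|.

Fact frob_is_zmod_morphism : zmod_morphism frob.
Proof.
move=> x y; apply/eqP; rewrite eq_sym subr_eq; apply/eqP.
by rewrite /frob -{1}(subrK y x) exprDn_pchar // pchar_nat_card.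
Qed.

Fact frob_is_monoid_morphism : monoid_morphism frob.
Proof. by split=> [|x y]; rewrite /frob ?expr1n ?exprMn. Qed.

HB.instance Definition _ := GRing.isZmodMorphism.Build L L frob frob_is_zmod_morphism.
HB.instance Definition _ := GRing.isMonoidMorphism.Build L L frob frob_is_monoid_morphism.

Lemma frob_iota x : frob (iota x) = iota x.
Proof. by rewrite /frob -rmorphXn expf_card. Qed.

(** A fixed element is a root of X^q - X, which already splits over F as the product of all X -
    y. *)
Lemma frob_fixedP x : reflect (exists y, x = iota y) (frob x == x).
Proof.
apply: (iffP eqP) => [fx|[y ->]]; last exact: frob_iota.
have := congr1 (fun p : {poly F} => (map_poly iota p).[x]) (finField_genPoly F).
rewrite rmorphB /= map_polyXn map_polyX hornerD hornerN hornerXn hornerX.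
rewrite -[x ^+ _]/(frob x) fx subrr rmorph_prod horner_prod => /esym/eqP.
case/prodf_eq0=> y _; rewrite rmorphB /= map_polyX map_polyC hornerXsubC subr_eq0.
by move/eqP=> ->; exists y.
Qed.

(** * Quadratic equations over F and equations of lines *)

Hypothesis cardL : #|L| = (#|F| ^ 2)%N.

Lemma frobK x : frob (frob x) = x.
Proof. by rewrite /frob -exprM mulnn -cardL expf_card. Qed.

Lemma quadratic_root (s n : F) : exists x, x ^+ 2 - iota s * x + iota n = 0.
Proof.
pose p : {poly L} := 'X^2 - (iota s)%:P * 'X + (iota n)%:P.
pose q := #|F|.
have expD (u v : {poly L}) : (u + v) ^+ q = u ^+ q + v ^+ q.
  rewrite exprDn_pchar // (eq_pnat _ (@pchar_poly L)).
  exact: pchar_nat_card.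
have q0 : (0 : {poly L}) ^+ q = 0.
  by rewrite expr0n /q; have := finNzRing_gt1 F; case: #|F|.
(* Deduced from additivity, which avoids a case on the parity of q. *)
have expN (u : {poly L}) : (- u) ^+ q = - (u ^+ q).
  by apply/eqP; rewrite -addr_eq0 -expD addNr q0.
have expC (y : F) : ((iota y)%:P : {poly L}) ^+ q = (iota y)%:P.
  by rewrite -polyC_exp -[_ ^+ q]/(frob _) frob_iota.
(* [A B = p^q - p] and ['X^(q^2) - 'X = A^q + A = B^q - B], so [p] divides the square of
   ['X^(q^2) - 'X], a product of linear factors. *)
pose A : {poly L} := 'X^q - 'X.
pose B : {poly L} := 'X^q + 'X - (iota s)%:P.
have AB : A * B = p ^+ q - p.
  rewrite /A /B /p !expD expN (exprMn q (iota s)%:P) !expC exprAC.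
  ring.
have Aq : 'X^#|L| - 'X = A ^+ q + A :> {poly L}.
  rewrite /A expD expN -exprM mulnn cardL; ring.
have Bq : 'X^#|L| - 'X = B ^+ q - B :> {poly L}.
  rewrite /B !expD expN expC -exprM mulnn cardL; ring.
have q_gt0 : (0 < q)%N by rewrite /q; have := finNzRing_gt1 F; case: #|F|.
have p_dvd : p %| ('X^#|L| - 'X) ^+ 2.
  rewrite expr2 {1}Aq Bq -(prednK q_gt0) !exprS.
  have -> : (A * A ^+ q.-1 + A) * (B * B ^+ q.-1 - B)
          = A * B * ((A ^+ q.-1 + 1) * (B ^+ q.-1 - 1)) by ring.
  rewrite dvdp_mulr // AB -(prednK q_gt0) exprS.
  have -> : p * p ^+ q.-1 - p = p * (p ^+ q.-1 - 1) by ring.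
  exact: dvdp_mulr.
have size_p : size p = 3.
  rewrite /p -addrA size_polyDl size_polyXn //.
  rewrite (leq_ltn_trans (size_polyD _ _)) // gtn_max size_polyN.
  rewrite (leq_ltn_trans (size_polyMleq _ _)) ?size_polyX /=; last first.
    by rewrite addn2 /= ltnS size_polyC; case: (_ != 0).
  by rewrite (leq_ltn_trans (size_polyC_leq1 _)).
have [/existsP[x /rootP]|/existsPn noroot] := boolP [exists x, root p x].
  by rewrite /p !hornerE; exists x.
(* Without a root, [p] is coprime to every X - x, hence to a polynomial that it divides; its degree
   2 forbids this. *)
have: coprimep p (('X^#|L| - 'X) ^+ 2).
  rewrite coprimep_expr // finField_genPoly.
  elim/big_rec: _ => [|x u _ pu]; first exact: coprimep1.
  by rewrite coprimepMr pu andbT coprimep_XsubC; exact: noroot.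
by rewrite /coprimep (eqp_size (dvdp_gcd_idl p_dvd)) size_p.
Qed.

(** The coefficient vector spans the orthogonal of [l], of rank 3 - 2 = 1. Kernels commute with
    extension of scalars, so the same [w] cuts out the line over L. *)
Lemma line_equation l : is_line l ->
  exists w : 'rV[F]_3, [/\ w != 0,
    forall v, (v \in l) = (w *m v == 0)
    & forall v, (v \in ext_line iota l) = (map_mx iota w *m v == 0)].
Proof.
move=> /eqP dl; pose X := vbasis l; pose B := \matrix_i (tnth X i)^T.
have lE v : (v \in l) = (v^T <= B)%MS.
  by rewrite -mem_span_submx (span_basis (vbasisP l)).
have extE v : (v \in ext_line iota l) = (v^T <= map_mx iota B)%MS.
  exact: mem_span_map_submx.
have rB : \rank B = 2%N.
  rewrite -[RHS]dl; apply/eqP/inj_row_free => D /(congr1 trmx).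
  rewrite mulmx_sum_row raddf_sum trmx0 /= => D0.
  have /freeP fX := basis_free (vbasisP l).
  apply/rowP=> i; rewrite mxE; apply: (fX (fun i => D 0 i)); rewrite -[RHS]D0.
  by apply: eq_bigr => j _; rewrite linearZ /= rowK trmxK (tnth_nth 0).
pose w := nz_row (kermx B^T).
have w0 : w != 0.
  by rewrite nz_row_eq0 -mxrank_eq0 mxrank_ker mxrank_tr rB.
have eqB : (B :=: kermx w^T)%MS.
  apply/eqmxP; rewrite -(geq_leqif (mxrank_leqif_eq _)).
    by rewrite mxrank_ker mxrank_tr rank_rV w0 rB.
  have /sub_kermxP := nz_row_sub (kermx B^T).
  by move/(congr1 trmx); rewrite trmx_mul trmxK trmx0 => h; apply/sub_kermxP.
exists w; split=> // v.
  by rewrite lE eqB sub_kermx -trmx_mul trmx_eq0.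
have -> : (v \in ext_line iota l) = (v^T <= kermx (map_mx iota w)^T)%MS.
  by rewrite extE map_trmx -map_kermx ((map_eqmx _ _ _).2 eqB).
by rewrite sub_kermx -trmx_mul trmx_eq0.
Qed.

(** * Conic points of a non-tangent line and the Frobenius action on them *)

Lemma mulmx_conic_pt_eq0 (K : fieldType) (w : 'rV[K]_3) x :
  (w *m conic_pt x == 0) =
  if x is Some t then w 0 0 * t + w 0 1 * t ^+ 2 + w 0 2%:R == 0 else w 0 1 == 0.
Proof.
have -> : (w *m conic_pt x == 0) = ((w *m conic_pt x) 0 0 == 0).
  apply/eqP/eqP=> [->|e]; first by rewrite mxE.
  by apply/rowP=> i; rewrite ord1 e mxE.
rewrite mxE !big_ord_recl big_ord0 addr0.
have -> : lift ord0 ord0 = 1 :> 'I_3 by apply: val_inj.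
have -> : lift ord0 (lift ord0 ord0) = 2%:R :> 'I_3 by apply: val_inj.
by case: x => [t|]; rewrite !mxE /= ?mulr1 ?mulr0 ?addr0 ?add0r ?addrA.
Qed.

(* The Frobenius fixes both conic points (s = false, hyperbolic) or exchanges them
   (s = true, elliptic). *)
Definition oriented (s : bool) l (a b : option L) :=
  [&& a != b, conic_params iota l == [set a; b],
      omap frob a == if s then b else a & omap frob b == if s then a else b].

Lemma orientedC s l a b : oriented s l a b = oriented s l b a.
Proof. by rewrite /oriented eq_sym setUC; case: s; rewrite [X in [&& _, _ & X]]andbC. Qed.

Lemma omap_frob_fixedP x : reflect (exists y, x = omap iota y) (omap frob x == x).
Proof.
apply: (iffP eqP) => [|[[y|] ->]] //=; last by rewrite frob_iota.
case: x => [x|] /=; last by exists None.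
by case=> /eqP/frob_fixedP[y ->]; exists (Some y).
Qed.

Lemma hyperbolicP l : hyperbolic iota l <-> exists a b, oriented false l a b.
Proof.
split=> [[a [b [ab pl]]]|[a [b /and4P[ab /eqP pl]]]].
  exists (omap iota a), (omap iota b); rewrite /oriented pl eqxx.
  have inj : injective (omap iota) by apply: inj_omap; apply: fmorph_inj.
  rewrite inj_eq // ab /=.
  by apply/andP; split; apply/omap_frob_fixedP; [exists a | exists b].
move=> /omap_frob_fixedP[a' ea] /omap_frob_fixedP[b' eb]; exists a', b'.
by rewrite -ea -eb; split=> //; apply: contraNneq ab => e; rewrite ea eb e.
Qed.

Lemma notin_codom_frob x : (x \notin codom iota) = (frob x != x).
Proof. by congr (~~ _); apply/codomP/frob_fixedP. Qed.

Lemma ellipticP l : elliptic iota l <-> exists a b, oriented true l a b.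
Proof.
split=> [[a [aF pl]]|[a [b /and4P[ab /eqP pl /eqP ea /eqP eb]]]].
  exists (Some a), (Some (frob a)); rewrite /oriented pl !eqxx /= frobK eqxx !andbT.
  by move: aF; rewrite notin_codom_frob; apply: contraNneq => -[<-].
case: a b ab pl ea eb => [a|] [b|] //= ab pl [ea] [eb].
exists a; rewrite notin_codom_frob ea; split; last by rewrite pl -ea.
by apply: contraNneq ab => ->.
Qed.

Lemma nontangent_oriented l : nontangent_line l ->
  exists s a b, oriented s l a b.
Proof.
case/andP=> dl; rewrite /tangent dl /=.
have [w [w0 lE extE]] := line_equation dl.
set S := [set x | _].
have SE x : (x \in S) = if x is Some t then
    w 0 0 * t + w 0 1 * t ^+ 2 + w 0 2%:R == 0 else w 0 1 == 0.
  by rewrite inE lE mulmx_conic_pt_eq0.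
have PE x : (x \in conic_params iota l) = if x is Some t then
    iota (w 0 0) * t + iota (w 0 1) * t ^+ 2 + iota (w 0 2%:R) == 0
    else w 0 1 == 0.
  by rewrite inE extE mulmx_conic_pt_eq0 !mxE fmorph_eq0.
move=> tangent_free.
have hyp (a b : option F) : a != b -> conic_params iota l = [set omap iota a; omap iota b] ->
    exists s a b, oriented s l a b.
  move=> ab pl; exists false; apply/hyperbolicP; exists a, b; split=> //.
case: (eqVneq (w 0 1) 0) => [w1|w1].
  case: (eqVneq (w 0 0) 0) => [w00|w00].
    (* Only the constant coefficient survives, and it is nonzero because [w != 0]: the line meets
       the conic at infinity alone, so it is tangent. *)
    case/eqP: tangent_free; apply/eqP/cards1P; exists None; apply/setP=> x.
    rewrite SE !inE; case: x => [t|]; last by rewrite w1 !eqxx.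
    rewrite w1 w00 !mul0r !add0r; apply: contraNF w0 => w2; apply/eqP/rowP=> i; rewrite mxE.
    have [->|[->|->]] : i = 0 \/ i = 1 \/ i = 2%:R.
      by case: i => [[|[|[|i]]] Hi] //; [left|right;left|right;right]; apply: val_inj.
    - by [].
    - by [].
    - exact/eqP.
  (* Infinity is one conic point; the other solves the remaining linear equation. *)
  apply: (hyp None (Some (- w 0 2%:R / w 0 0))) => //; apply/setP=> x.
  rewrite PE !inE; case: x => [t|]; last by rewrite w1 !eqxx.
  have iw00 : iota (w 0 0) != 0 by rewrite fmorph_eq0.
  rewrite w1 rmorph0 mul0r addr0 /= addr_eq0 fmorph_div rmorphN.
  by apply/eqP/eqP=> [<-|[->]]; [rewrite mulrAC divff // mul1r | rewrite mulrC divfK].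
(* The sum and the product of the roots of the normalized quadratic; [b] below is the second
   root. *)
pose s := - (w 0 0 / w 0 1); pose n := w 0 2%:R / w 0 1.
have [a rt] := quadratic_root s n.
pose b := iota s - a.
have iw1 : iota (w 0 1) != 0 by rewrite fmorph_eq0.
have fact t : iota (w 0 0) * t + iota (w 0 1) * t ^+ 2 + iota (w 0 2%:R) =
    iota (w 0 1) * ((t - a) * (t - b)).
  transitivity (iota (w 0 1) * (t ^+ 2 - iota s * t + iota n)).
    by rewrite /s /n rmorphN !fmorph_div; field.
  congr (_ * _); rewrite -[LHS]subr0 -rt /b; ring.
have pl : conic_params iota l = [set Some a; Some b].
  apply/setP=> -[t|]; rewrite PE !inE; last by rewrite (negPf w1).
  by rewrite fact !mulf_eq0 (negPf iw1) /= !subr_eq0.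
case: (altP (frob_fixedP a)) => [[a' ea]|fa].
  pose b' := s - a'; have eb : b = iota b' by rewrite /b ea rmorphB.
  apply: (hyp (Some a') (Some b')); last by rewrite /= -ea -eb.
  (* A double root in F would be the only conic point over F, making the line tangent. *)
  apply: contraNneq tangent_free => -[ab]; apply/cards1P; exists (Some a').
  apply/setP=> -[t|]; rewrite SE !inE; last by rewrite (negPf w1).
  rewrite -(fmorph_eq0 iota) !rmorphD (rmorphM _ (w 0 0)) (rmorphM _ (w 0 1)).
  rewrite rmorphXn fact !mulf_eq0 (negPf iw1) /=.
  by rewrite eb -ab ea orbb subr_eq0 (inj_eq (fmorph_inj iota)).
(* The equation has coefficients in F, so [frob a] is again a root; being different from [a], it is
   [b]. *)
have fb : frob a = b.
  have : iota (w 0 1) * ((frob a - a) * (frob a - b)) = 0.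
    rewrite -fact -[iota (w 0 0)]frob_iota -[iota (w 0 1)]frob_iota -[iota (w 0 2%:R)]frob_iota.
    rewrite -(rmorphXn frob) -!(rmorphM frob) -!(rmorphD frob) fact subrr.
    by rewrite !(mul0r, mulr0) rmorph0.
  move/eqP; rewrite !mulf_eq0 (negPf iw1) /= subr_eq0 (negPf fa) /= subr_eq0.
  by move/eqP.
by exists true; apply/ellipticP; exists a; rewrite notin_codom_frob fa pl -fb.
Qed.

Lemma same_typeP l l' : same_type iota l l' <->
  exists s, (exists a b, oriented s l a b) /\ (exists a b, oriented s l' a b).
Proof.
split=> [[[/hyperbolicP hl /hyperbolicP hl']|[/ellipticP el /ellipticP el']]|].
- by exists false.
- by exists true.
case=> -[] [lo lo']; first by right; split; apply/ellipticP.
by left; split; apply/hyperbolicP.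
Qed.

Lemma oriented_image (g : {'GL_3[F]}) A c s l a b :
    A \in unitmx -> c != 0 -> GLval g = c *: conic_mx A -> oriented s l a b ->
  oriented s (line_image g l) (mob (map_mx iota A) a) (mob (map_mx iota A) b).
Proof.
move=> uA c0 gE /and4P[ab /eqP pl /eqP ea /eqP eb].
set B := map_mx iota A; have uB : B \in unitmx by rewrite map_unitmx.
(* The entries of [B] come from F, so its Moebius map commutes with the Frobenius and keeps the
   orientation type [s]. *)
have frobB : map_mx frob B = B by apply/matrixP=> i j; rewrite !mxE /= frob_iota.
have frob_mob x : omap frob (mob B x) = mob B (omap frob x).
  by rewrite -mob_map // frobB.
rewrite /oriented (conic_params_image l uA c0 gE) -/B pl imsetU1 imset_set1 eqxx.
rewrite (can_eq (mobK uB)) ab !frob_mob ea eb /=.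
by case: (s); rewrite !eqxx.
Qed.

Lemma set2_eq (T : finType) (a b a' b' : T) : a != b -> [set a; b] = [set a'; b'] ->
  a = a' /\ b = b' \/ a = b' /\ b = a'.
Proof.
move=> ab e; have := set21 a b; have := set22 a b; rewrite e !inE.
move=> /orP[] /eqP eb /orP[] /eqP ea; [|by right|by left|];
  by move: ab; rewrite ea eb eqxx.
Qed.

Lemma line_cross_ratioE l m a b c d : a != b -> c != d ->
    conic_params iota l = [set a; b] -> conic_params iota m = [set c; d] ->
  line_cross_ratio iota l m =
  [set cross_ratio a b c d; proj_inv (cross_ratio a b c d)].
Proof.
move=> ab cd pl pm; apply/setP=> x; rewrite inE; apply/idP/idP => [|xr]; last first.
  apply/existsP; exists a; apply/existsP; exists b.
  apply/existsP; exists c; apply/existsP; exists d.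
  by rewrite ab cd pl pm !eqxx xr.
case/existsP=> a1 /existsP[b1 /existsP[c1 /existsP[d1]]].
rewrite pl pm => /and5P[ab1 /eqP eab cd1 /eqP ecd].
have sw := cross_ratio_swap12 ab cd.
have ba : b != a by rewrite eq_sym.
have dc : d != c by rewrite eq_sym.
have sw' := cross_ratio_swap12 ba cd.
have [[<- <-]|[<- <-]] := set2_eq ab eab; have [[<- <-]|[<- <-]] := set2_eq cd ecd => //.
- by rewrite cross_ratio_swap34 sw proj_invK setUC.
- by rewrite sw proj_invK setUC.
- by rewrite cross_ratio_swap34.
Qed.

(** * Descent of Moebius maps from L to F *)

Lemma mx_descent p q (M : 'M[L]_(p, q)) k : M != 0 -> map_mx frob M = k *: M ->
  exists2 c : L, c != 0 & exists A : 'M[F]_(p, q), M = c *: map_mx iota A.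
Proof.
move=> M0 frobM.
have /existsP[i /existsP[j Mij]] : [exists i, exists j, M i j != 0].
  apply: contraNT M0 => /existsPn Z; apply/eqP/matrixP=> i j; rewrite mxE.
  by have /existsPn/(_ j) := Z i; rewrite negbK => /eqP.
exists (M i j) => //.
(* The Frobenius multiplies all entries by the same [k], so their quotients by one nonzero entry are
   fixed and lie in F. *)
pose N := (M i j)^-1 *: M.
have fM i' j' : frob (M i' j') = k * M i' j'.
  by move/matrixP/(_ i' j'): frobM; rewrite !mxE.
have k0 : k != 0.
  by apply: contraNneq Mij => k0; rewrite -(fmorph_eq0 frob) /= fM k0 mul0r.
have fN i' j' : exists y, N i' j' == iota y.
  have /frob_fixedP[y ->] : frob (N i' j') == N i' j'.
    rewrite mxE rmorphM fmorphV /= !fM; apply/eqP; field; exact/andP.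
  by exists y.
exists (\matrix_(i', j') xchoose (fN i' j')).
apply/matrixP=> i' j'; rewrite !mxE -(eqP (xchooseP (fN i' j'))) mxE.
by rewrite mulrA divff ?mul1r.
Qed.

(** Distinct lines cannot share both conic points, so one point of [m] avoids [l]. It supplies the
    third point needed to determine a Moebius map. *)
Lemma oriented_third_point s t l m a b c d : is_line l -> is_line m -> l <> m ->
    oriented s l a b -> oriented t m c d ->
  exists c' d', [/\ oriented t m c' d', a != c' & b != c'].
Proof.
move=> dl dm lm ol om.
have [/andP[ac bc]|] := boolP ((a != c) && (b != c)); first by exists c, d.
have [/andP[ad bd] _|] := boolP ((a != d) && (b != d)).
  by exists d, c; rewrite orientedC.
case/and4P: ol => ab /eqP pl _ _; case/and4P: om => cd /eqP pm _ _.
move=> h1 h2; case: lm; apply: (conic_params_inj dl dm ab pl); rewrite pm.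
move: h1 h2 cd; rewrite !negb_and !negbK.
by move=> /orP[] /eqP <- /orP[] /eqP <-; rewrite ?eqxx // setUC.
Qed.

(** With a common [s], the Frobenius permutes a, b in the same way as a', b'; conjugating M a = a'
    and M b = b' therefore gives the same two conditions. *)
Lemma oriented_descent s l l' a b a' b' (M : 'M[L]_2) : M \in unitmx ->
    oriented s l a b -> oriented s l' a' b' -> mob M a = a' -> mob M b = b' ->
  mob (map_mx frob M) a = a' /\ mob (map_mx frob M) b = b'.
Proof.
move=> uM /and4P[_ _ /eqP ea /eqP eb] /and4P[_ _ /eqP ea' /eqP eb'] Ma Mb.
have fM x : mob (map_mx frob M) (omap frob x) = omap frob (mob M x).
  exact: mob_map.
have := fM a; have := fM b; rewrite Ma Mb ea eb ea' eb'.
by case: (s) => -> ->.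
Qed.

Lemma is_line_image (g : {'GL_3[F]}) l : is_line l -> is_line (line_image g l).
Proof.
rewrite /is_line => /eqP dl; rewrite -[X in _ == X]dl; apply/eqP/limg_dim_eq.
suff /eqP -> : lker (linfun (mulmx (GLval g) : 'cV[F]_3 -> 'cV[F]_3)) == 0%VS by rewrite capv0.
apply/lker0P=> u v; rewrite !lfunE /= => /(congr1 (mulmx (invmx (GLval g)))).
by rewrite !mulKmx // GL_unitmx.
Qed.

(** Agreement at three points makes [M] proportional to its conjugate, so [mx_descent] replaces it
    by a matrix over F with the same Moebius map. *)
Lemma conic_group_descent (M : 'M[L]_2) x y z : M \in unitmx ->
    x != y -> x != z -> y != z ->
    mob (map_mx frob M) x = mob M x -> mob (map_mx frob M) y = mob M y ->
    mob (map_mx frob M) z = mob M z ->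
  exists2 g, g \in conic_group F & forall l,
    conic_params iota (line_image g l) = mob M @: conic_params iota l.
Proof.
move=> uM xy xz yz ex ey ez.
have uM' : map_mx frob M \in unitmx by rewrite map_unitmx.
have [k _ frobM] := mob_proportional uM' uM xy xz yz ex ey ez.
have M0 : M != 0.
  by apply: contraTneq uM => ->; rewrite unitmxE det0 unitr0.
have [c c0 [A MA]] := mx_descent M0 frobM.
have uB : map_mx iota A \in unitmx.
  by move: uM; rewrite MA unitmxE detZ unitrM => /andP[_]; rewrite -unitmxE.
have uA : A \in unitmx by rewrite map_unitmx in uB.
pose h : {'GL_2[F]} := FinRing.unit _ uA.
pose g : {'GL_3[F]} := FinRing.unit _ (conic_mx_unit uA).
exists g.
  rewrite inE; apply/existsP; exists h; apply/existsP; exists 1.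
  by rewrite oner_eq0 scale1r /=.
move=> l; rewrite (@conic_params_image g A 1) ?oner_eq0 ?scale1r //.
by apply: eq_imset => u; rewrite MA mobZ.
Qed.

End QuadraticExtension.

Theorem mainTheorem5 (F L : finFieldType) (iota : {rmorphism F -> L})
    (cardL : #|L| = (#|F| ^ 2)%N)
    (l m l' m' : {vspace 'cV[F]_3})
    (nt_l : nontangent_line l) (nt_m : nontangent_line m)
    (nt_l' : nontangent_line l') (nt_m' : nontangent_line m')
    (neq_lm : l <> m) (neq_lm' : l' <> m') :
  (exists2 g : {'GL_3[F]}, g \in conic_group F &
     line_image g l = l' /\ line_image g m = m')
  <->
  [/\ same_type iota l l', same_type iota m m'
    & line_cross_ratio iota l m = line_cross_ratio iota l' m'].
Proof.
case/andP: (nt_l) => dl _; case/andP: (nt_m) => dm _.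
case/andP: nt_l' => dl' _; case/andP: nt_m' => dm' _.
split=> [[g]|[]].
  rewrite inE => /existsP[h /existsP[c /andP[c0 /eqP gE]]] [<- <-].
  have uA : GLval h \in unitmx := GL_unitmx h.
  have [s [a [b ol]]] := nontangent_oriented iota cardL nt_l.
  have [t [x [y om]]] := nontangent_oriented iota cardL nt_m.
  have ol' := oriented_image uA c0 gE ol; have om' := oriented_image uA c0 gE om.
  split.
  - apply/(same_typeP iota cardL); exists s; split; first by exists a, b.
    by do 2 eexists; exact: ol'.
  - apply/(same_typeP iota cardL); exists t; split; first by exists x, y.
    by do 2 eexists; exact: om'.
  case/and4P: ol => ab /eqP pl _ _; case/and4P: om => xy /eqP pm _ _.
  case/and4P: ol' => ab' /eqP pl' _ _; case/and4P: om' => xy' /eqP pm' _ _.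
  rewrite (line_cross_ratioE ab xy pl pm) (line_cross_ratioE ab' xy' pl' pm').
  by rewrite cross_ratio_mob // map_unitmx.
move=> /(same_typeP iota cardL)[s [[a [b ol]] [a' [b' ol']]]].
move=> /(same_typeP iota cardL)[t [[x [y om]] [x' [y' om']]]].
have {x y om} [c [d [om ac bc]]] := oriented_third_point dl dm neq_lm ol om.
have {x' y' om'} [c' [d' [om' ac' bc']]] := oriented_third_point dl' dm' neq_lm' ol' om'.
case/and4P: (ol) => ab /eqP pl _ _; case/and4P: (om) => cd /eqP pm _ _.
case/and4P: (om') => cd' /eqP pm' _ _.
move=> lcr.
(* Equality of the sets leaves r' = r or its inverse; in the second case the labels a' and b' are
   exchanged. *)
wlog rr : a' b' ol' ac' bc' / cross_ratio a b c d = cross_ratio a' b' c' d'.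
  move=> base.
  case/and4P: (ol') => ab' /eqP pl' _ _.
  move: lcr; rewrite (line_cross_ratioE ab cd pl pm) (line_cross_ratioE ab' cd' pl' pm').
  move/setP/(_ (cross_ratio a b c d)); rewrite set21 => /esym /set2P[] rr.
    exact: (base a' b').
  by apply: (base b' a') => //; rewrite ?(orientedC iota s l' b') // rr -cross_ratio_swap12.
case/and4P: (ol') => ab' /eqP pl' _ _.
have [M uM [Ma Mb Mc]] := mob_transitive3 ab ac bc ab' ac' bc'.
have Md : mob M d = d'.
  by apply: (cross_ratio_inj ab' ac' bc'); rewrite -rr -(cross_ratio_mob a b c d uM) Ma Mb Mc.
have [Ma2 Mb2] := oriented_descent uM ol ol' Ma Mb.
(* The Frobenius may exchange c and d, so control of the conjugate at c depends on [Md] as well. *)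
have [Mc2 _] := oriented_descent uM om om' Mc Md.
have [||| g gO gE] := conic_group_descent iota uM ab ac bc; rewrite ?Ma2 ?Mb2 ?Mc2 //.
exists g => //; split.
  apply: (conic_params_inj _ dl' ab' _ pl'); first exact: is_line_image.
  by rewrite gE pl imsetU1 imset_set1 Ma Mb.
apply: (conic_params_inj _ dm' cd' _ pm'); first exact: is_line_image.
by rewrite gE pm imsetU1 imset_set1 Mc Md.
Qed.
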